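(* (1) For every Stone algebra $\mathcal{S}=(S,\vee,\wedge,\sim,0,1)$ there exists a set $U$ such that $\mathcal{S}$ can be embedded into the Stone algebra formed by $(\mathcal{P}(U))^{[2]}$. (2) For every dual Stone algebra $\mathcal{DS}=(DS,\vee,\wedge,\neg,0,1)$ there exists a set $U$ such that $\mathcal{DS}$ can be embedded into the dual Stone algebra formed by $(\mathcal{P}(U))^{[2]}$.
   Context: A Stone algebra is an algebra $(S,\vee,\wedge,\sim,0,1)$ such that $(S,\vee,\wedge,0,1)$ is a bounded distributive lattice, for every $a\in S$ the element $\sim a=\max\{c\in S: a\wedge c=0\}$ exists, and $\sim a\vee\sim\sim a=1$ for all $a$. A dual Stone algebra is an algebra $(D,\vee,\wedge,\neg,0,1)$ such that $(D,\vee,\wedge,0,1)$ is a bounded distributive lattice, for every $a\in D$ the element $\neg a=\min\{c\in D: a\vee c=1\}$ exists, and $\neg a\wedge\neg\neg a=0$ for all $a$. The one-element algebra is allowed. For a set $U$, $(\mathcal{P}(U))^{[2]}:=\{(A,B): A\subseteq B\subseteq U\}$ with componentwise union and intersection as $\vee,\wedge$, bottom $(\emptyset,\emptyset)$ and top $(U,U)$. It is a Stone algebra with $\sim(A,B):=(B^{c},B^{c})$ and a dual Stone algebra with $\neg(A,B):=(A^{c},A^{c})$, where $^{c}$ is complement in $U$. Embeddings preserve all operations of the signature, including $0$ and $1$. *)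

(* Defs.v *)
From HB Require Import structures.
From mathcomp Require Import all_boot all_order.
From mathcomp Require Import boolp classical_sets.

Set Implicit Arguments.
Unset Strict Implicit.
Unset Printing Implicit Defensive.

Import Order.TTheory.
Local Open Scope classical_set_scope.

(* The carrier of a tbDistrLatticeType is a choiceType; boolp's gen_eqMixin and
   gen_choiceMixin provide this structure on every type, so it does not
   restrict which lattices are covered. 0 = 1 is allowed. *)
HB.mixin Record hasStoneNegation d (T : Type) of Order.TBDistrLattice d T := {
  sneg : T -> T;
  sneg_in : forall a : T, [set c : T | (a `&` c = \bot)%O] (sneg a);
  sneg_ub : forall a : T, ubound [set c : T | (a `&` c = \bot)%O] (sneg a);
  sneg_stone : forall a : T, (sneg a `|` sneg (sneg a) = \top)%O
}.

#[short(type="stoneAlgebraType")]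
HB.structure Definition StoneAlgebra d :=
  { T of hasStoneNegation d T & Order.TBDistrLattice d T }.

HB.mixin Record hasDualStoneNegation d (T : Type)
    of Order.TBDistrLattice d T := {
  dneg : T -> T;
  dneg_in : forall a : T, [set c : T | (a `|` c = \top)%O] (dneg a);
  dneg_lb : forall a : T, lbound [set c : T | (a `|` c = \top)%O] (dneg a);
  dneg_stone : forall a : T, (dneg a `&` dneg (dneg a) = \bot)%O
}.

#[short(type="dualStoneAlgebraType")]
HB.structure Definition DualStoneAlgebra d :=
  { T of hasDualStoneNegation d T & Order.TBDistrLattice d T }.

(* The library's {tblmorphism _ -> _} only records preservation of \bot and
   \top, so preservation of meets and joins is spelled out. *)
Definition tblattice_embedding d1 d2 (L : tbDistrLatticeType d1)
    (M : tbDistrLatticeType d2) (f : L -> M) : Prop :=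
  [/\ injective f,
      {morph f : x y / (x `|` y)%O},
      {morph f : x y / (x `&` y)%O},
      f \bot%O = \bot%O
    & f \top%O = \top%O].

Definition stone_embedding d1 d2 (S : stoneAlgebraType d1)
    (S' : stoneAlgebraType d2) (f : S -> S') : Prop :=
  tblattice_embedding f /\ {morph f : x / sneg x}.

Definition dual_stone_embedding d1 d2 (D : dualStoneAlgebraType d1)
    (D' : dualStoneAlgebraType d2) (f : D -> D') : Prop :=
  tblattice_embedding f /\ {morph f : x / dneg x}.

Record nested_pair (U : Type) := NestedPair {
  inner : set U;
  outer : set U;
  inner_outer : inner `<=` outer
}.

Section NestedPair.
Variable U : Type.
Implicit Types p q r : nested_pair U.

Lemma nested_pair_eq p q : inner p = inner q -> outer p = outer q -> p = q.
Proof.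
case: p q => [A B AB] [A' B' AB'] /= eA eB; subst A' B'.
by rewrite (Prop_irrelevance AB AB').
Qed.

HB.instance Definition _ := gen_eqMixin (nested_pair U).
HB.instance Definition _ := gen_choiceMixin (nested_pair U).

Definition np_le p q : bool :=
  `[< inner p `<=` inner q /\ outer p `<=` outer q >].
Definition np_lt p q : bool := (q != p) && np_le p q.
Definition np_meet p q : nested_pair U :=
  NestedPair (setISS (@inner_outer _ p) (@inner_outer _ q)).
Definition np_join p q : nested_pair U :=
  NestedPair (setUSS (@inner_outer _ p) (@inner_outer _ q)).
Definition np_bot : nested_pair U := NestedPair (@subset_refl _ set0).
Definition np_top : nested_pair U := NestedPair (@subset_refl _ setT).
Definition np_sneg p : nested_pair U :=
  NestedPair (@subset_refl _ (~` outer p)).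
Definition np_dneg p : nested_pair U :=
  NestedPair (@subset_refl _ (~` inner p)).

Fact np_le_def p q : np_le p q = (np_meet p q == p).
Proof.
apply/asboolP/eqP => [[/setIidPl i /setIidPl o]|<-].
  exact: nested_pair_eq.
by split=> x [].
Qed.

Fact np_lt_def p q : np_lt p q = (q != p) && np_le p q.
Proof. by []. Qed.

Fact np_meetC : commutative np_meet.
Proof. by move=> p q; apply: nested_pair_eq; rewrite /= setIC. Qed.

Fact np_joinC : commutative np_join.
Proof. by move=> p q; apply: nested_pair_eq; rewrite /= setUC. Qed.

Fact np_meetA : associative np_meet.
Proof. by move=> p q r; apply: nested_pair_eq; rewrite /= setIA. Qed.

Fact np_joinA : associative np_join.
Proof. by move=> p q r; apply: nested_pair_eq; rewrite /= setUA. Qed.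

Fact np_joinKI q p : np_meet p (np_join p q) = p.
Proof. by apply: nested_pair_eq; rewrite /= setUC setKU. Qed.

Fact np_meetKU q p : np_join p (np_meet p q) = p.
Proof. by apply: nested_pair_eq; rewrite /= setIC setKI. Qed.

Fact np_meetUl : left_distributive np_meet np_join.
Proof. by move=> p q r; apply: nested_pair_eq; rewrite /= setIUl. Qed.

Fact np_meetxx : idempotent_op np_meet.
Proof. by move=> p; apply: nested_pair_eq; rewrite /= setIid. Qed.

HB.instance Definition _ :=
  Order.isMeetJoinDistrLattice.Build set_display (nested_pair U)
    np_le_def np_lt_def np_meetC np_joinC np_meetA np_joinA
    np_joinKI np_meetKU np_meetUl np_meetxx.

Fact np_le0x p : (np_bot <= p)%O.
Proof. by apply/asboolP; split; apply: sub0set. Qed.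

Fact np_lex1 p : (p <= np_top)%O.
Proof. by apply/asboolP; split. Qed.

HB.instance Definition _ :=
  Order.hasBottom.Build set_display (nested_pair U) np_le0x.
HB.instance Definition _ :=
  Order.hasTop.Build set_display (nested_pair U) np_lex1.

Fact np_sneg_in p :
  [set q : nested_pair U | (p `&` q = \bot)%O] (np_sneg p).
Proof.
apply: nested_pair_eq; rewrite /= ?setICr //.
apply/seteqP; split=> x //= [xi nxo].
exact: (nxo (inner_outer xi)).
Qed.

Fact np_sneg_ub p :
  ubound [set q : nested_pair U | (p `&` q = \bot)%O] (np_sneg p).
Proof.
move=> q /= pq0; have o0 : outer p `&` outer q = set0.
  exact: (congr1 (@outer U) pq0).
have qo : outer q `<=` ~` outer p.
  by move=> x xq xp; rewrite -[False]/(set0 x) -o0.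
apply/asboolP; split=> //=.
exact: subset_trans (@inner_outer _ q) qo.
Qed.

Fact np_sneg_stone p : (np_sneg p `|` np_sneg (np_sneg p) = \top)%O.
Proof. by apply: nested_pair_eq; rewrite /= setUCr. Qed.

HB.instance Definition _ :=
  hasStoneNegation.Build set_display (nested_pair U)
    np_sneg_in np_sneg_ub np_sneg_stone.

Fact np_dneg_in p :
  [set q : nested_pair U | (p `|` q = \top)%O] (np_dneg p).
Proof.
apply: nested_pair_eq; rewrite /= ?setUCr //.
apply/seteqP; split=> x //= _.
have [xi|nxi] := pselect (inner p x); [left; exact: inner_outer | by right].
Qed.

Fact np_dneg_lb p :
  lbound [set q : nested_pair U | (p `|` q = \top)%O] (np_dneg p).
Proof.
move=> q /= pq1; have i1 : inner p `|` inner q = setT.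
  exact: (congr1 (@inner U) pq1).
have iq : ~` inner p `<=` inner q.
  by move=> x nxp; have : [set: U] x by []; rewrite -i1 => -[].
apply/asboolP; split=> //=.
exact: subset_trans iq (@inner_outer _ q).
Qed.

Fact np_dneg_stone p : (np_dneg p `&` np_dneg (np_dneg p) = \bot)%O.
Proof. by apply: nested_pair_eq; rewrite /= setICr. Qed.

HB.instance Definition _ :=
  hasDualStoneNegation.Build set_display (nested_pair U)
    np_dneg_in np_dneg_lb np_dneg_stone.

End NestedPair.

(* Main.v *)
(** In a Stone algebra [a |-> ~~a] is a lattice endomorphism whose values
are complemented. Over the set of prime filters of S, the map
[a |-> ({F | a \in F}, {F | ~~a \in F})] is therefore an embedding: a prime
filter contains exactly one element of each complementary pair, and prime
filters separate points. For (2), embed the order dual of D, which is a Stone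
algebra, and compose with the anti-automorphism [(A, B) |-> (B^c, A^c)] of the
nested pairs, which exchanges the two negations. *)
Require Import Defs.
From HB Require Import structures.
From mathcomp Require Import all_boot all_order.
From mathcomp Require Import boolp classical_sets.

Set Implicit Arguments.
Unset Strict Implicit.
Unset Printing Implicit Defensive.

Import Order.TTheory.
Local Open Scope classical_set_scope.
Local Open Scope order_scope.

Definition prime_filter d (L : tbDistrLatticeType d) (F : set L) : Prop :=
  [/\ F \top, ~ F \bot,
      forall x y, F (x `&` y) <-> F x /\ F y
    & forall x y, F (x `|` y) <-> F x \/ F y].

(** Zorn gives a filter maximal among those that contain [a] and avoid [b]; maximality and
    distributivity make it prime. *)
Lemma prime_filter_separation d (L : tbDistrLatticeType d) (a b : L) :
  ~~ (a <= b) -> exists F : set L, [/\ prime_filter F, F a & ~ F b].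
Proof.
move=> nab.
(* The last clause lets the empty set through, as Zorn_bigcup requires. *)
pose P (X : set L) := [/\ forall x y, X x -> X y -> X (x `&` y),
  forall x y, x <= y -> X x -> X y, ~ X b & forall x, X x -> X a].
have [|M [[MI Mup Mb MnE] Mmax]] := @Zorn_bigcup L P.
  move=> C CP Ctot; split.
  - move=> x y [X CX Xx] [Y CY Yy].
    have [XY|YX] := Ctot _ _ CX CY.
      by exists Y => //; have [+ _ _ _] := CP _ CY; apply=> //; apply: XY.
    by exists X => //; have [+ _ _ _] := CP _ CX; apply=> //; apply: YX.
  - move=> x y xy [X CX Xx]; exists X => //.
    by have [_ Xup _ _] := CP _ CX; apply: Xup xy Xx.
  - by move=> [X CX Xb]; have [_ _ + _] := CP _ CX; apply.
  - move=> x [X CX Xx]; exists X => //.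
    by have [_ _ _ Xa] := CP _ CX; apply: Xa Xx.
(* Otherwise [MnE] makes [M] empty, and the principal filter of [a], which avoids [b], properly
   extends it. *)
have Ma : M a.
  apply: contrapT => nMa; apply: (Mmax [set x | a <= x]).
    split=> [x /MnE//|/(_ a) /=].
    by rewrite lexx => /(_ isT).
  split=> /=.
  - by move=> x y ax ay; rewrite lexI ax.
  - by move=> x y xy ax; apply: le_trans xy.
  - exact/negP.
  - by [].
(* The filter generated by [M] and [x] properly extends [M], so by maximality it contains [b]. *)
have adjoin x : ~ M x -> exists2 m, M m & m `&` x <= b.
  move=> nMx; apply: contrapT => nmb.
  apply: (Mmax [set z | exists2 m, M m & m `&` x <= z]).
    split=> [z Mz|Mz]; first by exists z => //; apply: leIl.
    by apply: nMx; apply: Mz; exists a => //; apply: leIr.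
  split=> //=.
  - move=> y z [m Mm my] [n Mn nz]; exists (m `&` n); first exact: MI.
    by rewrite lexI (le_trans _ my) ?(le_trans _ nz) ?leI2 ?leIl ?leIr.
  - by move=> y z yz [m Mm my]; exists m => //; apply: le_trans yz.
  - by move=> *; exists a => //; apply: leIl.
exists M; split=> //; split.
- exact: Mup (lex1 a) Ma.
- by move=> /(Mup _ _ (le0x b)).
- move=> x y; split=> [Mxy|[]]; last exact: MI.
  by split; apply: Mup Mxy; [apply: leIl|apply: leIr].
- move=> x y; split=> [Mxy|[]]; last 2 first.
  + exact/Mup/leUl.
  + exact/Mup/leUr.
  (* If [x] and [y] both lay outside [M], distributivity would put an element of [M] below [b]. *)
  apply: contrapT => /not_orP[/adjoin[m Mm mx] /adjoin[n Mn ny]].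
  apply: Mb; apply: (Mup (m `&` n `&` (x `|` y))).
    rewrite meetUr leUx (le_trans _ mx) ?leI2 ?leIl //=.
    by rewrite (le_trans _ ny) ?leI2 ?leIr.
  exact: (MI _ _ (MI _ _ Mm Mn) Mxy).
Qed.

Section StoneTheory.
Context {d : Order.disp_t} {S : stoneAlgebraType d}.
Implicit Types a b c : S.

Lemma le_sneg a c : (c <= sneg a) = (a `&` c == \bot).
Proof.
apply/idP/eqP => [ca|]; last exact: sneg_ub.
by apply: le_anti; rewrite le0x andbT -[leRHS](sneg_in a) leI2.
Qed.

Lemma le_sneg_sneg a : a <= sneg (sneg a).
Proof. by rewrite le_sneg meetC; apply/eqP/sneg_in. Qed.

Lemma sneg_anti a b : a <= b -> sneg b <= sneg a.
Proof.
by move=> ab; rewrite le_sneg -lex0 -(sneg_in b : b `&` _ = _) leI2.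
Qed.

Lemma sneg3 a : sneg (sneg (sneg a)) = sneg a.
Proof. by apply: le_anti; rewrite le_sneg_sneg sneg_anti ?le_sneg_sneg. Qed.

Lemma sneg0 : sneg (\bot : S) = \top.
Proof. by apply/eqP; rewrite -le1x le_sneg meet0x. Qed.

Lemma sneg1 : sneg (\top : S) = \bot.
Proof. by have := sneg_in (\top : S); rewrite /= meet1x. Qed.

Lemma snegU a b : sneg (a `|` b) = sneg a `&` sneg b.
Proof.
apply: le_anti; rewrite lexI !sneg_anti ?leUl ?leUr //= le_sneg meetUl.
by rewrite meetA (sneg_in a : a `&` _ = _) meetCA (sneg_in b : b `&` _ = _)
  meet0x meetx0 joinx0.
Qed.

(* If z := ~(a /\ b) then z /\ a <= ~b, so z /\ ~~b <= ~a; now split z along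
   ~b \/ ~~b = 1. *)
Lemma snegI a b : sneg (a `&` b) = sneg a `|` sneg b.
Proof.
apply: le_anti; rewrite leUx !sneg_anti ?leIl ?leIr // !andbT.
set z := sneg _; have zab : a `&` b `&` z = \bot by exact: sneg_in.
rewrite -[z]meetx1 -(sneg_stone b) meetUr leUx.
rewrite lexU2 ?leIr ?orbT //= lexU2 // le_sneg.
have az : a `&` z <= sneg b by rewrite le_sneg meetCA meetA zab.
rewrite meetA -lex0 -(sneg_in (sneg b) : sneg b `&` _ = _).
by rewrite leI2.
Qed.

(** The two elements meet in [\bot] and, by the Stone identity, join to [\top]. *)
Lemma prime_filter_sneg (F : set S) a :
  prime_filter F -> F (sneg a) <-> ~ F (sneg (sneg a)).
Proof.
move=> [F1 F0 FI FU]; split=> [Fa Faa|nFaa].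
  by apply: F0; rewrite -(sneg_in (sneg a) : sneg a `&` _ = _); apply/FI.
by move: F1; rewrite -(sneg_stone a) => /FU[].
Qed.

Let U := {F : set S | prime_filter F}.

Lemma stone_rep_subproof a :
  [set F : U | sval F a] `<=` [set F : U | sval F (sneg (sneg a))].
Proof.
move=> [F [_ _ FI _]] /= Fa.
by move: Fa; rewrite -{1}(meet_idPl (le_sneg_sneg a)) => /FI[].
Qed.

Definition stone_rep a : nested_pair U := NestedPair (@stone_rep_subproof a).

Lemma stone_rep_embedding : stone_embedding stone_rep.
Proof.
split; first split.
(* Inner components alone give injectivity: if [a <= b] failed, some prime filter would contain [a]
   but not [b]. *)
- suff le_of_rep a b : stone_rep a = stone_rep b -> a <= b.
    by move=> a b ab; apply: le_anti; rewrite !le_of_rep.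
  move=> /(congr1 (@inner U)) /= ab.
  apply: contrapT => /negP /prime_filter_separation[F [pF Fa]]; apply.
  by rewrite -[F b]/([set G : U | sval G b] (exist _ F pF)) -ab.
(* Inner components use primality directly; outer ones first carry the double negation through the
   join by both De Morgan laws. *)
- by move=> a b; apply: nested_pair_eq; rewrite /= ?snegU ?snegI;
    apply/seteqP; split=> -[F pF] /=; have [_ _ _ FU] := pF => /FU.
- by move=> a b; apply: nested_pair_eq; rewrite /= ?snegI ?snegU;
    apply/seteqP; split=> -[F pF] /=; have [_ _ FI _] := pF => /FI.
- by apply: nested_pair_eq; rewrite /= ?sneg0 ?sneg1;
    apply/seteqP; split=> -[F pF] //=; have [_ F0 _ _] := pF.
- by apply: nested_pair_eq; rewrite /= ?sneg1 ?sneg0;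
    apply/seteqP; split=> -[F pF] //=; have [F1 _ _ _] := pF.
(* By [sneg3], both components of the image of [sneg a] consist of the filters containing
   [sneg a]. *)
- by move=> a; apply: nested_pair_eq; rewrite /= ?sneg3;
    apply/seteqP; split=> -[F pF] /=; have [] := prime_filter_sneg a pF.
Qed.

End StoneTheory.

Section DualStone.
Context {d : Order.disp_t} {D : dualStoneAlgebraType d}.

(** The axioms match by conversion: [D^d] swaps meet with join and [\bot] with [\top], and its upper
    bounds are the lower bounds of [D]. *)
HB.instance Definition _ :=
  hasStoneNegation.Build _ (D^d)
    (@dneg_in d D) (@dneg_lb d D) (@dneg_stone d D).

End DualStone.

Lemma np_compl_subproof U (p : nested_pair U) :
  ~` outer p `<=` ~` inner p.
Proof. exact/subsetC/inner_outer. Qed.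

Definition np_compl U (p : nested_pair U) := NestedPair (@np_compl_subproof U p).

Lemma np_complK U : involutive (@np_compl U).
Proof. by move=> p; apply: nested_pair_eq; rewrite /= setCK. Qed.

Lemma stone_embedding_dual d (D : dualStoneAlgebraType d) U
    (f : D^d -> nested_pair U) :
  stone_embedding f -> dual_stone_embedding (@np_compl U \o f : D -> _).
Proof.
move=> [[finj fU fI f0 f1] fN]; split; first split.
- exact: inj_comp (can_inj (@np_complK U)) finj.
(* The join of [D] is the meet of [D^d], hence [fI] here; complementation then turns intersections
   into unions. *)
- move=> x y /=; rewrite (fI x y).
  by apply: nested_pair_eq; rewrite /= setCI.
- move=> x y /=; rewrite (fU x y).
  by apply: nested_pair_eq; rewrite /= setCU.
- rewrite /= f1; by apply: nested_pair_eq; rewrite /= setCT.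
- rewrite /= f0; by apply: nested_pair_eq; rewrite /= setC0.
(* On both sides each component is the double complement of [outer (f x)]. *)
- move=> x /=; rewrite (fN x).
  by apply: nested_pair_eq; rewrite /= setCK.
Qed.

Theorem theorem5 :
  (forall (d : Order.disp_t) (S : stoneAlgebraType d),
     exists (U : Type) (f : S -> nested_pair U), stone_embedding f) /\
  (forall (d : Order.disp_t) (D : dualStoneAlgebraType d),
     exists (U : Type) (f : D -> nested_pair U), dual_stone_embedding f).
Proof.
split=> d T; first by exists _, stone_rep; apply: stone_rep_embedding.
exists _, (@np_compl _ \o @stone_rep _ T^d).
exact/stone_embedding_dual/stone_rep_embedding.
Qed.
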